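(* Up to isomorphism, there are exactly two finite connected $(v_3)$ graphs that are B-irreducible: the Heawood graph and the Pappus graph. That is, a finite connected bipartite cubic simple graph of girth at least $6$ admits no reduction (in the sense defined in the context) yielding again a bipartite cubic simple graph of girth at least $6$ if and only if it is isomorphic to the Heawood graph or to the Pappus graph.
   Context: A $(v_3)$ graph is a finite simple bipartite cubic (3-regular) graph of girth at least $6$; its two colour classes are called black and white (each of size $v$). Reduction of a bipartite cubic graph $G$ by a black vertex $u$ and a white vertex $v$: delete $u$ and $v$ and join their remaining neighbours so that the result is again cubic and bipartite. Precisely, if $u$ and $v$ are non-adjacent, $u$ has white neighbours $a_1,a_2,a_3$ and $v$ has black neighbours $b_1,b_2,b_3$, and one adds the three edges of a perfect matching between $\{a_1,a_2,a_3\}$ and $\{b_1,b_2,b_3\}$ (six possible choices); if $u$ and $v$ are adjacent, $u$ has further neighbours $a_1,a_2$ and $v$ has further neighbours $b_1,b_2$, and one adds the two edges of a perfect matching between $\{a_1,a_2\}$ and $\{b_1,b_2\}$ (two possible choices). A $(v_3)$ graph $G$ is B-reducible if some reduction of $G$ by some black vertex $u$ and some white vertex $v$ yields a $(v_3)$ graph (in particular simple, with girth at least $6$); otherwise $G$ is B-irreducible. The Heawood graph is the incidence graph of the Fano plane (14 vertices; LCF notation $[5,-5]^7$). The Pappus graph is the incidence graph of the Pappus $(9_3)$ configuration (18 vertices; LCF notation $[5,7,-7,7,-7,-5]^3$). *)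

(* Defs.v *)
From mathcomp Require Import all_boot all_order all_algebra.
Set Implicit Arguments. Unset Strict Implicit. Unset Printing Implicit Defensive.

Section Graphs.
Variable T : finType.
Implicit Types (e : rel T).

Definition simple_graph e : Prop := symmetric e /\ irreflexive e.

Definition cubic e : Prop := forall x : T, #|[set y | e x y]| = 3.

(* proper 2-colouring (true = black, false = white) *)
Definition proper2col e (c : T -> bool) : Prop :=
  forall x y, e x y -> c x != c y.

Definition bipartite e : Prop := exists c : T -> bool, proper2col e c.

Definition girth_ge6 e : Prop :=
  forall p : seq T, uniq p -> 3 <= size p -> cycle e p -> 6 <= size p.

Definition v3_graph e : Prop :=
  [/\ simple_graph e, cubic e, bipartite e & girth_ge6 e].

Definition connected_graph e : Prop :=
  (exists x : T, True) /\ forall x y : T, connect e x y.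

(* A reduction by u and v is given by the set M of added edges: a perfect
   matching between the remaining neighbours of u (i.e. N(u) \ {v}) and the
   remaining neighbours of v (i.e. N(v) \ {u}).  This covers both the
   non-adjacent case (3+3 neighbours, 6 matchings) and the adjacent case
   (2+2 neighbours, 2 matchings). *)
Definition red_matching e (u v : T) (M : rel T) : Prop :=
  [/\ forall x y, M x y -> [&& e u x, x != v, e v y & y != u],
      forall x, e u x -> x != v -> #|[set y | M x y]| = 1 &
      forall y, e v y -> y != u -> #|[set x | M x y]| = 1].

(* the added edges are new (otherwise the result has parallel edges,
   i.e. is not simple) *)
Definition red_new_edges e (M : rel T) : Prop :=
  forall x y, M x y -> ~~ e x y.

Definition red_vertex (u v : T) := {x : T | (x != u) && (x != v)}.

Definition red_rel e (u v : T) (M : rel T) : rel (red_vertex u v) :=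
  fun x y => [|| e (val x) (val y), M (val x) (val y) | M (val y) (val x)].

End Graphs.

Arguments red_vertex {T} u v.
Arguments red_rel {T} e u v M _ _.
Arguments red_matching {T} e u v M.
Arguments red_new_edges {T} e M.

Definition B_reducible (T : finType) (e : rel T) : Prop :=
  exists c : T -> bool, proper2col e c /\
  exists (u v : T) (M : rel T),
    [/\ c u, ~~ c v, red_matching e u v M, red_new_edges e M &
        v3_graph (red_rel e u v M)].

Definition B_irreducible (T : finType) (e : rel T) : Prop := ~ B_reducible e.


Definition isomorphic (T T' : finType) (e : rel T) (e' : rel T') : Prop :=
  exists f : T -> T', bijective f /\ forall x y, e' (f x) (f y) = e x y.

(* LCF notation [L]^k on n vertices (n = k * size L): vertices 0..n-1 on a
   Hamiltonian cycle, vertex i additionally joined to i + L_(i mod size L)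
   (mod n). *)
Local Open Scope ring_scope.
Definition lcf_step (n : nat) (a : 'I_n) (d : int) (b : 'I_n) : bool :=
  (b%:Z == ((a%:Z + d) %% n%:Z)%Z).

Definition lcf_graph (n : nat) (L : seq int) : rel 'I_n :=
  fun x y => [|| lcf_step x 1 y, lcf_step y 1 x,
                 lcf_step x (nth 0 L (x %% size L)%N) y
               | lcf_step y (nth 0 L (y %% size L)%N) x].

Arguments lcf_step n a d b : clear implicits.
Arguments lcf_graph n L x y : clear implicits.

Definition heawood : rel 'I_14 := lcf_graph 14 [:: 5; -5].

Definition pappus : rel 'I_18 := lcf_graph 18 [:: 5; 7; -7; 7; -7; -5].

(* Main.v *)
Require Import Defs.
From mathcomp Require Import all_boot all_order all_algebra.
Set Implicit Arguments. Unset Strict Implicit. Unset Printing Implicit Defensive.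

(* Whether a reduction by u and v yields girth at least 6 depends only on a ball
   around u and v: no matched pair (a, b) may be adjacent or joined by a path of
   length 3 avoiding u and v, and no two matched pairs may be joined crosswise.
   Hence irreducibility forces many hexagons, and growing a graph from one vertex,
   deciding adjacencies one at a time, soon either meets a reduction whose success
   no longer depends on the undecided part, or closes up to the Heawood or the
   Pappus graph.  The finite case tree is given as data and checked by a verified
   function; a branch may also end because its partial graph contains an earlier
   one.  Its two milestones: two vertices joined by three paths of length 3 (state 6
   of [certificates]) lead to the Heawood graph, and in their absence two hexagons
   sharing a path of length 2 (state 17) lead to the Pappus graph.
   Irreducibility of the two graphs themselves is a finite computation. *)

(** * Reductions *)

Section FourCycles.
Variables (T : finType) (e : rel T).

Lemma girth_ge6_no_C4 (x y z w : T) :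
  simple_graph e -> girth_ge6 e ->
  e x y -> e y z -> e z w -> e w x -> x != z -> y != w -> False.
Proof.
move=> [sym irr] girth exy eyz ezw ewx xz yw.
have ne a b : e a b -> a != b by apply: contraTneq => ->; rewrite irr.
suff: 6 <= size [:: x; y; z; w] by [].
apply: girth => //=; last by rewrite exy eyz ezw ewx.
by rewrite !inE !negb_or xz yw (ne _ _ exy) (ne _ _ eyz) (ne _ _ ezw) eq_sym (ne _ _ ewx).
Qed.

(** The colouring excludes cycles of length 3 and 5, so only 4-cycles threaten girth 6. *)
Lemma no_C4_girth_ge6 (c : T -> bool) :
  proper2col e c ->
  (forall x y z w, e x y -> e y z -> e z w -> e w x -> x != z -> y != w -> False) ->
  girth_ge6 e.
Proof.
move=> col noC4 [|x [|y [|z [|w [|t [|? ?]]]]]] //=.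
- move=> _ _ /and4P [/col exy /col eyz /col ezx _].
  by case: (c x) (c y) (c z) exy eyz ezx => [] [] [].
- move=> /and4P [n1 n2 _ _] _ /and5P [exy eyz ezw ewx _].
  case: (noC4 x y z w) => //.
    by move: n1; rewrite !inE !negb_or => /and3P [].
  by move: n2; rewrite !inE !negb_or => /andP [].
- move=> _ _ /and5P [/col exy /col eyz /col ezw /col ewt /andP [/col etx _]].
  by case: (c x) (c y) (c z) (c w) (c t) exy eyz ezw ewt etx => [] [] [] [] [].
Qed.

End FourCycles.

Lemma proper2col_negb (T : finType) (e : rel T) c :
  proper2col e c -> proper2col e (fun x => ~~ c x).
Proof. by move=> col x y /col; case: (c x) (c y) => [] []. Qed.

Lemma red_matching_sym (T : finType) (e : rel T) u v (M : rel T) :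
  red_matching e u v M -> red_matching e v u (fun x y => M y x).
Proof.
case=> h1 h2 h3; split=> [x y /h1 | x | y]; last 2 first.
- exact: h3.
- exact: h2.
by case/and4P=> -> -> -> ->.
Qed.

Section Reduction.
Variables (T : finType) (e : rel T) (c : T -> bool).
Hypotheses (sg : simple_graph e) (cub : cubic e) (colP : proper2col e c).

(** A neighbour of [u] loses the edge to [u] and gains exactly one matched edge, which is new, so
    the degree stays 3. The count is made in [T], before passing to the subtype [red_vertex]. *)
Lemma red_degree_nbr u v (M : rel T) (x : T) :
  c u != c v -> red_matching e u v M -> red_new_edges e M -> e u x -> x != v ->
  #|[set t | [&& t != u, t != v & [|| e x t, M x t | M t x]]]| = 3.
Proof.
move=> cuv [hM hM1 hM2] new eux xv; case: sg => sym irr.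
have cx := colP eux.
have -> : [set t | [&& t != u, t != v & [|| e x t, M x t | M t x]]]
        = ([set t | e x t] :\ u) :|: [set t | M x t].
  apply/setP=> t; rewrite !inE.
  (* Otherwise [x] would be adjacent to both [u] and [v], which have different colours. *)
  have NM : M t x = false.
    apply/negP=> /hM /and4P [_ _ evx _].
    by move: (colP evx) cx cuv; case: (c u) (c v) (c x) => [] [] [].
  rewrite NM orbF; have [-> /=|tu] /= := eqVneq t u.
    by apply/esym/negP=> /hM; rewrite eqxx !andbF.
  have [->|//] := eqVneq t v; apply/esym/negP=> /orP [exv|/hM].
    by move: (colP exv) cx cuv; case: (c u) (c v) (c x) => [] [] [].
  by rewrite irr !andbF.
rewrite cardsU (hM1 _ eux xv).
have -> : ([set t | e x t] :\ u) :&: [set t | M x t] = set0.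
  apply/setP=> t; rewrite !inE; apply/negP=> /andP [/andP [_ ext] /new].
  by rewrite ext.
rewrite cards0 subn0; have := cub x; rewrite (cardsD1 u) inE sym eux.
by rewrite add1n; case=> ->.
Qed.

Lemma red_degree u v (M : rel T) (x : T) :
  c u != c v -> red_matching e u v M -> red_new_edges e M -> x != u -> x != v ->
  #|[set t | [&& t != u, t != v & [|| e x t, M x t | M t x]]]| = 3.
Proof.
move=> cuv rM new xu xv; case: (sg) => sym irr.
have [eux|neux] := boolP (e u x); first exact: red_degree_nbr.
have [evx|nevx] := boolP (e v x).
  (* Exchanging [u] and [v] and transposing [M] reduces neighbours of [v] to neighbours of [u]. *)
  rewrite -(@red_degree_nbr v u (fun y z => M z y) x) //.
  - by apply: eq_card => t; rewrite !inE andbCA [M x t || _]orbC.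
  - by rewrite eq_sym.
  - exact: red_matching_sym.
  - by move=> y z /new; rewrite sym.
rewrite -(cub x); apply: eq_card => t; rewrite !inE.
case: rM => hM _ _.
have -> : M x t = false by apply/negP=> /hM; rewrite (negbTE neux).
have -> : M t x = false by apply/negP=> /hM; rewrite (negbTE nevx) !andbF.
rewrite !orbF; have [->|tu] := eqVneq t u; first by rewrite sym (negbTE neux).
by have [->|//] := eqVneq t v; rewrite sym (negbTE nevx).
Qed.

Hypothesis girth : girth_ge6 e.

(** Sort the possible 4-cycles of the result by their edges in [M]. With none the cycle lies in [e];
    with one it leaves a path of length 3 in [e]; two opposite ones are a crosswise pair; two
    consecutive ones contradict that [M] is a matching. In the path condition the colours already
    give [x != v] and [y != u]. *)
Lemma reduction_v3 u v (M : rel T) :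
  c u != c v -> red_matching e u v M -> red_new_edges e M ->
  (forall a x y b, M a b -> e a x -> x != u -> e x y -> y != v -> e y b -> False) ->
  (forall a b a' b', M a b -> M a' b' -> e a b' -> e a' b -> False) ->
  v3_graph (red_rel e u v M).
Proof.
move=> cuv rM new no3 nocr; case: (sg) => sym irr; case: (rM) => hM hM1 hM2.
have McolL x y : M x y -> c x = ~~ c u.
  by case/hM/and4P=> /colP; case: (c x) (c u) => [] [].
have McolR x y : M x y -> c y = c u.
  by case/hM/and4P=> _ _ /colP; move: cuv; case: (c y) (c u) (c v) => [] [] [].
have Mcol x y : M x y -> c x != c y.
  by move=> m; rewrite (McolL _ _ m) (McolR _ _ m); case: (c u).
have Mfun x y y' : M x y -> M x y' -> y = y'.
  move=> m m'; have /and4P [eux xv _ _] := hM _ _ m.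
  move/eqP: (hM1 x eux xv) => /cards1P [t /setP st].
  by move: (st y) (st y'); rewrite !inE m m' => /esym /eqP -> /esym /eqP ->.
have Minj x x' y : M x y -> M x' y -> x = x'.
  move=> m m'; have /and4P [_ _ evy yu] := hM _ _ m.
  move/eqP: (hM2 y evy yu) => /cards1P [t /setP st].
  by move: (st x) (st x'); rewrite !inE m m' => /esym /eqP -> /esym /eqP ->.
set R := red_rel e u v M.
have symR : symmetric R.
  by move=> x y; rewrite /R /red_rel sym [M _ _ || _]orbC.
have Rcol : proper2col R (fun x => c (val x)).
  move=> x y /or3P [|m|m]; [exact: colP | exact: Mcol | rewrite eq_sym; exact: Mcol].
split.
- split=> // x; apply/negP=> rxx; by move: (Rcol _ _ rxx); rewrite eqxx.
- move=> x; have /andP [xu xv] := valP x.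
  rewrite -(red_degree cuv rM new xu xv) -(card_imset _ val_inj).
  apply: eq_card => t; rewrite inE; apply/imsetP/idP => [[y]|].
    by rewrite inE => rxy ->; have /andP [-> ->] := valP y.
  case/and3P=> tu tv rxt.
  have tP : (t != u) && (t != v) by rewrite tu.
  by exists (Sub t tP); rewrite ?inE ?SubK // /R /red_rel SubK.
- by exists (fun x => c (val x)).
apply: (no_C4_girth_ge6 Rcol).
(* Starting the cycle in the colour class of the neighbours of [u] makes all its matched edges point
   from [x] or [z] to [y] or [w]. *)
have key (x y z w : red_vertex u v) : c (val x) = ~~ c u ->
    R x y -> R y z -> R z w -> R w x -> x != z -> y != w -> False.
  move=> cx rxy ryz rzw rwx xz yw.
  have cy : c (val y) = c u by move: (Rcol _ _ rxy); rewrite cx; case: (c u) (c (val y)) => [] [].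
  have cz : c (val z) = ~~ c u by move: (Rcol _ _ ryz); rewrite cy; case: (c u) (c (val z)) => [] [].
  have cw : c (val w) = c u by move: (Rcol _ _ rzw); rewrite cz; case: (c u) (c (val w)) => [] [].
  have orient (p q : red_vertex u v) : c (val p) = ~~ c u -> c (val q) = c u ->
      R p q -> e (val p) (val q) \/ M (val p) (val q).
    move=> cp cq /or3P [|->|m]; [by left | by right |].
    by move: (McolL _ _ m); rewrite cq; case: (c u).
  rewrite symR in ryz; rewrite symR in rwx.
  have nx : val x != val z by rewrite val_eqE.
  have ny : val y != val w by rewrite val_eqE.
  have /andP [xu xv] := valP x; have /andP [yu yv] := valP y.
  have /andP [zu zv] := valP z; have /andP [wu wv] := valP w.
  move: (orient _ _ cx cy rxy) (orient _ _ cz cy ryz)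
        (orient _ _ cz cw rzw) (orient _ _ cx cw rwx).
  move: nx ny xu xv yu yv zu zv wu wv.
  move: (val x) (val y) (val z) (val w) => {rxy ryz rzw rwx cx cy cz cw xz yw} {}x {}y {}z {}w.
  (* Sixteen cases: each of the four edges is old or matched. *)
  move=> nx ny xu xv yu yv zu zv wu wv [exy|mxy] [ezy|mzy] [ezw|mzw] [exw|mxw].
  - by apply: (@girth_ge6_no_C4 _ e x y z w) => //; rewrite sym.
  - by apply: (no3 x y z w mxw); rewrite // sym.
  - by apply: (no3 z y x w mzw); rewrite // sym.
  - by move: nx; rewrite (Minj _ _ _ mzw mxw) eqxx.
  - by apply: (no3 z w x y mzy); rewrite // sym.
  - exact: (nocr x w z y).
  - by move: ny; rewrite (Mfun _ _ _ mzw mzy) eqxx.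
  - by move: ny; rewrite (Mfun _ _ _ mzw mzy) eqxx.
  - by apply: (no3 x w z y mxy); rewrite // sym.
  - by move: ny; rewrite (Mfun _ _ _ mxy mxw) eqxx.
  - exact: (nocr x y z w).
  - by move: ny; rewrite (Mfun _ _ _ mxy mxw) eqxx.
  - by move: nx; rewrite (Minj _ _ _ mxy mzy) eqxx.
  - by move: nx; rewrite (Minj _ _ _ mxy mzy) eqxx.
  - by move: nx; rewrite (Minj _ _ _ mxy mzy) eqxx.
  - by move: nx; rewrite (Minj _ _ _ mxy mzy) eqxx.
move=> x y z w rxy ryz rzw rwx xz yw.
have [cx|cx] := eqVneq (c (val x)) (~~ c u); first exact: (key x y z w).
(* If [x] is in the wrong class, the cycle is rotated by one. *)
apply: (key y z w x) => //; last by rewrite eq_sym.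
by move: (Rcol _ _ rxy) cx; case: (c (val x)) (c (val y)) (c u) => [] [] [].
Qed.

(** [B_reducible] asks for a black [u] but leaves the colouring free, so when [u] is white the
    colours are exchanged rather than the two vertices. *)
Lemma reduction_B_reducible u v (M : rel T) :
  c u != c v -> red_matching e u v M -> red_new_edges e M ->
  (forall a x y b, M a b -> e a x -> x != u -> e x y -> y != v -> e y b -> False) ->
  (forall a b a' b', M a b -> M a' b' -> e a b' -> e a' b -> False) ->
  B_reducible e.
Proof.
move=> cuv rM new no3 nocr; have v3 := reduction_v3 cuv rM new no3 nocr.
have [cu|cu] := boolP (c u).
  exists c; split=> //; exists u, v, M; split=> //.
  by move: cuv; rewrite cu; case: (c v).
exists (fun x => ~~ c x); split; first exact: proper2col_negb.
exists u, v, M; split=> //.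
by move: cuv; rewrite (negbTE cu); case: (c v).
Qed.

End Reduction.

(** * Partial graphs and certificates *)

Definition memn (y : nat) (l : seq nat) : bool := has (eqn y) l.

Lemma memnE y l : memn y l = (y \in l).
Proof. by rewrite /memn -has_pred1; apply: eq_has => z; rewrite /= eq_sym. Qed.

(* A vertex of a partial graph: its colour, its known neighbours, and vertices
   known not to be adjacent to it. *)
Definition vertex := (bool * seq nat * seq nat)%type.
Definition state := seq vertex.

Definition vtx0 : vertex := (true, [::], [::]).
Definition colour (s : state) x : bool := (nth vtx0 s x).1.1.
Definition adj (s : state) x : seq nat := (nth vtx0 s x).1.2.
Definition nonadj (s : state) x : seq nat := (nth vtx0 s x).2.
Definition full (s : state) x : bool := eqn (size (adj s x)) 3.

Fixpoint update (g : vertex -> vertex) (s : state) (x : nat) : state :=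
  match s, x with
  | [::], _ => [::]
  | v :: s', 0 => g v :: s'
  | v :: s', x'.+1 => v :: update g s' x'
  end.

Definition add_nbrs (l : seq nat) (v : vertex) : vertex := (v.1.1, v.1.2 ++ l, v.2).
Definition add_arc (s : state) x y := update (add_nbrs [:: y]) s x.
Definition add_edge (s : state) x y := add_arc (add_arc s x y) y x.
(** The non-edge is stored at [x] only; [surely_nonadj] consults the lists of both ends. *)
Definition add_nonedge (s : state) x y :=
  update (fun v : vertex => (v.1, y :: v.2)) s x.

Definition add_missing (s : state) x : state :=
  let k := 3 - size (adj s x) in
  update (add_nbrs (iota (size s) k)) s x ++ nseq k (~~ colour s x, [:: x], [::]).

(** Such a path forbids the edge between [x] and [y], which would close a 4-cycle. *)
Definition three_path (s : state) x y : bool :=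
  has (fun z => ~~ eqn z y &&
    has (fun w => ~~ eqn w x && memn y (adj s w)) (adj s z)) (adj s x).

Definition surely_nonadj (s : state) x y : bool :=
  [|| eqb (colour s x) (colour s y),
      full s x && ~~ memn y (adj s x), full s y && ~~ memn x (adj s y),
      memn y (nonadj s x), memn x (nonadj s y) | three_path s x y].

(** These are the hypotheses of [reduction_B_reducible], read off a partial graph. Matched vertices
    must be full, so that both inner vertices of a path of length 3 between them are already known
    and only its middle edge needs excluding. *)
Definition reduction_ok (s : state) u v (bs : seq nat) : bool :=
  let M := zip (filter (fun a => ~~ eqn a v) (adj s u)) bs in
  [&& u < size s, v < size s, ~~ eqb (colour s u) (colour s v), full s u, full s v,
      eqn (size bs) (size (filter (fun a => ~~ eqn a v) (adj s u))), uniq bs,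
      all (fun b => memn b (adj s v) && ~~ eqn b u) bs,
      all (fun b => eqn b u || memn b bs) (adj s v),
      all (fun p => [&& full s p.1, full s p.2, surely_nonadj s p.1 p.2 &
             all (fun x => eqn x u ||
               all (fun y => eqn y v || surely_nonadj s x y) (adj s p.2)) (adj s p.1)]) M &
      all (fun p => all (fun q =>
             [|| eqn p.1 q.1, surely_nonadj s p.1 q.2 | surely_nonadj s q.1 p.2]) M) M].

(** Designed so that composing a realisation of [s] with [g] realises [L]: edges of [L] must be
    recorded in [s], while its non-edges need only be forced there. *)
Definition embedding_ok (L s : state) (flip : bool) (g : seq nat) : bool :=
  [&& eqn (size g) (size L), uniq g, all (fun y => y < size s) g &
    all (fun x => [&& eqb (colour L x) (flip (+) colour s (nth 0 g x)), uniq (adj L x),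
        all (fun y => (y < size L) && memn (nth 0 g y) (adj s (nth 0 g x))) (adj L x) &
        all (fun y => (y < size L) && surely_nonadj s (nth 0 g x) (nth 0 g y)) (nonadj L x)])
      (iota 0 (size L))].

(** Fullness and closure of [g] under adjacency make its vertices a whole connected component once
    the target is nonempty and connectedness of the ambient graph is used. *)
Definition isomorphism_ok (tbl : seq (seq nat)) (s : state) (g : seq nat) : bool :=
  [&& eqn (size g) (size tbl), uniq g &
    all (fun i => [&& nth 0 g i < size s, full s (nth 0 g i),
        all (fun y => memn y g) (adj s (nth 0 g i)) &
        all (fun j => eqb (memn (nth 0 g j) (adj s (nth 0 g i))) (memn j (nth [::] tbl i)))
          (iota 0 (size tbl))])
      (iota 0 (size tbl))].

(* [Branch x y] branches on whether [x] and [y] are adjacent; [Fill x] adds the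
   missing neighbours of [x]; [Reduce u v bs] exhibits a reduction by [u] and [v]
   matching the remaining neighbours of [u] with [bs]; [Embed k b g] embeds the
   [k]-th previously treated state by [g], exchanging the colours if [b];
   [Identify k g] identifies a closed state with the [k]-th target graph. *)
Inductive cert :=
| Branch of nat & nat & cert & cert
| Fill of nat & cert
| Reduce of nat & nat & seq nat
| Embed of nat & bool & seq nat
| Identify of nat & seq nat.

(** [Fill] first checks that adjacency of [x] to every known vertex is settled; only then must the
    missing neighbours be new vertices. *)
Fixpoint check (tbls : seq (seq (seq nat))) (lems : seq state) (t : cert) (s : state)
    : bool :=
  match t with
  | Branch x y t1 t2 =>
      [&& x < size s, y < size s, ~~ memn y (adj s x), ~~ memn x (adj s y), ~~ eqn x y,
          check tbls lems t1 (add_edge s x y) & check tbls lems t2 (add_nonedge s x y)]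
  | Fill x t1 =>
      [&& x < size s,
          all (fun y => memn y (adj s x) || surely_nonadj s x y) (iota 0 (size s)) &
          check tbls lems t1 (add_missing s x)]
  | Reduce u v bs => reduction_ok s u v bs
  | Embed k b g => (k < size lems) && embedding_ok (nth [::] lems k) s b g
  | Identify k g => (k < size tbls) && isomorphism_ok (nth [::] tbls k) s g
  end.

Fixpoint check_all (tbls : seq (seq (seq nat))) (lems : seq state)
    (todo : seq (state * cert)) : bool :=
  if todo is (s, t) :: todo' then
    check tbls lems t s && check_all tbls (rcons lems s) todo'
  else true.

Lemma size_update g s x : size (update g s x) = size s.
Proof. by elim: s x => [|v s IH] [|x] //=; rewrite IH. Qed.

Lemma nth_update g s x y : x < size s ->
  nth vtx0 (update g s x) y = if y == x then g (nth vtx0 s x) else nth vtx0 s y.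
Proof. by elim: s x y => [|v s IH] [|x] [|y] //= lt; rewrite IH. Qed.

Definition table_rel (tbl : seq (seq nat)) : rel 'I_(size tbl) :=
  fun i j => memn j (nth [::] tbl i).

Arguments table_rel : clear implicits.

(** * Soundness of the certificate checker *)

Section Soundness.
Variables (T : finType) (e : rel T).
Hypothesis v3 : v3_graph e.

(** A realisation of the partial graph inside [e]. Pairs on which [s] is silent may or may not be
    adjacent in [e], and values of [f] from [size s] on are irrelevant. *)
Record models (c : T -> bool) (f : nat -> T) (s : state) : Prop := Models {
  models_proper : proper2col e c;
  models_colour : forall x, x < size s -> c (f x) = colour s x;
  models_inj : forall x y, x < size s -> y < size s -> f x = f y -> x = y;
  models_adj : forall x y, y \in adj s x -> y < size s /\ e (f x) (f y);
  models_uniq : forall x, uniq (adj s x);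
  models_nonadj : forall x y, y \in nonadj s x -> y < size s /\ ~~ e (f x) (f y) }.

Let sym : symmetric e. Proof. by case: v3 => -[]. Qed.
Let cub : cubic e. Proof. by case: v3. Qed.
Let sg : simple_graph e. Proof. by case: v3. Qed.
Let girth : girth_ge6 e. Proof. by case: v3. Qed.

Lemma adj_size s x y : y \in adj s x -> x < size s.
Proof. by rewrite ltnNge; apply: contraL => le; rewrite /adj nth_default. Qed.

Lemma nonadj_size s x y : y \in nonadj s x -> x < size s.
Proof. by rewrite ltnNge; apply: contraL => le; rewrite /nonadj nth_default. Qed.

Section Model.
Variables (c : T -> bool) (f : nat -> T) (s : state).
Hypothesis m : models c f s.

Lemma map_adj_uniq x : uniq [seq f y | y <- adj s x].
Proof.
rewrite map_inj_in_uniq ?(models_uniq m) // => y z /(models_adj m) [ly _].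
by case/(models_adj m) => lz _; apply: (models_inj m).
Qed.

(** Three distinct known neighbours exhaust the neighbourhood in a cubic graph. *)
Lemma full_nbr x t : full s x -> e (f x) t -> exists2 y, y \in adj s x & t = f y.
Proof.
move=> /eqnP fx ext; apply/mapP.
have sub : {subset [seq f y | y <- adj s x] <= enum [set t | e (f x) t]}.
  by move=> _ /mapP [y /(models_adj m) [_ exy] ->]; rewrite mem_enum inE.
have [|_ ->] := uniq_min_size (map_adj_uniq x) sub.
  by rewrite -cardE cub size_map fx.
by rewrite mem_enum inE.
Qed.

Lemma full_nonadj x y : y < size s -> full s x -> y \notin adj s x -> ~~ e (f x) (f y).
Proof.
move=> ly fx; apply: contra => /(full_nbr fx) [z zx eqf].
by rewrite (models_inj m _ _ eqf) //; case: (models_adj m zx).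
Qed.

Lemma surely_nonadjP x y : x < size s -> y < size s ->
  surely_nonadj s x y -> ~~ e (f x) (f y).
Proof.
move=> lx ly; rewrite /surely_nonadj !memnE => /or4P [/eqP ceq|||].
- apply/negP=> /(models_proper m).
  by rewrite (models_colour m lx) (models_colour m ly) ceq eqxx.
- by case/andP; apply: full_nonadj.
- by case/andP; rewrite sym; apply: full_nonadj.
case/or3P=> [/(models_nonadj m) [] //| |].
  by rewrite sym; case/(models_nonadj m).
case/hasP=> z zx /andP [/eqnP zy /hasP [w wz /andP [/eqnP wx]]]; rewrite memnE => yw.
case: (models_adj m zx) (models_adj m wz) (models_adj m yw) => lz exz [lw ezw] [_ ewy].
apply/negP=> exy; apply: (girth_ge6_no_C4 sg girth exz ezw ewy).
- by rewrite sym.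
- by apply/eqP=> /(models_inj m lx lw) /esym.
- by apply/eqP=> /(models_inj m lz ly).
Qed.

Lemma reduction_okP u v bs : reduction_ok s u v bs -> B_reducible e.
Proof.
rewrite /reduction_ok; set as_ := filter _ _; set M := zip _ _.
case/and5P=> lu lv cuv fu /and5P [fv /eqnP sz ubs /allP bsP /and3P [/allP vP /allP M1 /allP M2]].
have uas : uniq as_ by rewrite filter_uniq // (models_uniq m).
have asP a : a \in as_ = (a != v) && (a \in adj s u) by rewrite mem_filter.
have bsE b : b \in bs = (b != u) && (b \in adj s v).
  apply/idP/andP => [/bsP /andP [] |[bu /vP]]; first by rewrite memnE => ? ?.
  by rewrite memnE; case/orP=> // /eqnP bu'; rewrite bu' eqxx in bu.
have M_as p : p \in M -> p.1 \in as_.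
  by move=> pM; rewrite -(unzip1_zip (s := as_) (t := bs)) ?sz // map_f.
have M_bs p : p \in M -> p.2 \in bs.
  by move=> pM; rewrite -(unzip2_zip (s := as_) (t := bs)) ?sz // map_f.
have las a : a \in as_ -> a < size s by rewrite asP => /andP [_ /(models_adj m) []].
have lbs b : b \in bs -> b < size s by rewrite bsE => /andP [_ /(models_adj m) []].
(* Neither [as_] nor [bs] has repetitions, so a pair of [M] is determined by either component. *)
have Mfun p q : p \in M -> q \in M -> p.1 = q.1 -> p = q.
  have U : uniq (unzip1 M) by rewrite unzip1_zip // sz.
  move=> pM qM E; apply/eqP; rewrite -(nth_index p pM) -(nth_index p qM).
  rewrite nth_uniq ?index_mem //; last exact: map_uniq U.
  rewrite -(nth_uniq p.1 _ _ U) ?size_map ?index_mem //.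
  by rewrite !(nth_map p) ?index_mem // !nth_index // E.
have Minj p q : p \in M -> q \in M -> p.2 = q.2 -> p = q.
  have U : uniq (unzip2 M) by rewrite unzip2_zip // sz.
  move=> pM qM E; apply/eqP; rewrite -(nth_index p pM) -(nth_index p qM).
  rewrite nth_uniq ?index_mem //; last exact: map_uniq U.
  rewrite -(nth_uniq p.2 _ _ U) ?size_map ?index_mem //.
  by rewrite !(nth_map p) ?index_mem // !nth_index // E.
(* The added edges in [e] are the image of the matching [M] of the partial graph. *)
pose R : rel T := fun t t' => has (fun p => (f p.1 == t) && (f p.2 == t')) M.
have RP t t' : R t t' -> exists2 p, p \in M & t = f p.1 /\ t' = f p.2.
  by case/hasP=> p pM /andP [/eqP <- /eqP <-]; exists p.
have RI p : p \in M -> R (f p.1) (f p.2).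
  by move=> pM; apply/hasP; exists p; rewrite // !eqxx.
apply: (@reduction_B_reducible T e c sg cub (models_proper m) girth (f u) (f v) R).
- rewrite (models_colour m lu) (models_colour m lv).
  by case: (colour s u) (colour s v) cuv => [] [].
- split.
  + move=> x y /RP [p pM [-> ->]]; move: (M_as p pM) (M_bs p pM) => pa pb.
    move: (las _ pa) (lbs _ pb) => l1 l2.
    move: pa pb; rewrite asP bsE => /andP [p1v /(models_adj m) [_ ->]].
    case/andP=> p2u /(models_adj m) [_ ->] /=.
    apply/andP; split; first by apply: contra p1v => /eqP /(models_inj m l1 lv) ->.
    by apply: contra p2u => /eqP /(models_inj m l2 lu) ->.
  + move=> x /(full_nbr fu) [a au ->] xv.
    have aas : a \in as_ by rewrite asP au andbT; apply: contra xv => /eqP ->.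
    have : a \in unzip1 M by rewrite unzip1_zip // sz.
    case/mapP=> p pM pa; apply/eqP/cards1P; exists (f p.2); apply/setP=> t; rewrite !inE.
    apply/idP/eqP=> [/RP [q qM [Ea ->]]|->]; last by rewrite pa; apply: RI.
    have aq : p.1 = q.1 by rewrite -pa; apply: (models_inj m) Ea; apply: las => //; apply: M_as.
    by rewrite (Mfun p q pM qM aq).
  + move=> y /(full_nbr fv) [b bv ->] yu.
    have bbs : b \in bs by rewrite bsE bv andbT; apply: contra yu => /eqP ->.
    have : b \in unzip2 M by rewrite unzip2_zip // sz.
    case/mapP=> p pM pb; apply/eqP/cards1P; exists (f p.1); apply/setP=> t; rewrite !inE.
    apply/idP/eqP=> [/RP [q qM [-> Eb]]|->]; last by rewrite pb; apply: RI.
    have bq : p.2 = q.2 by rewrite -pb; apply: (models_inj m) Eb; apply: lbs => //; apply: M_bs.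
    by rewrite (Minj p q pM qM bq).
- move=> x y /RP [p pM [-> ->]]; case/and4P: (M1 p pM) => _ _ na _.
  by apply: surely_nonadjP => //; [apply: las; apply: M_as | apply: lbs; apply: M_bs].
- move=> a x y b /RP [p pM [-> ->]]; case/and4P: (M1 p pM) => f1 f2 _ /allP pP.
  (* Fullness of the two ends turns the inner vertices of the path into known vertices [z] and
     [w]. *)
  move=> /(full_nbr f1) [z zp ->] zu; rewrite sym => exy yv; rewrite sym.
  case/(full_nbr f2) => w wp yw; move: exy yv; rewrite {}yw => ewz wv.
  move: (pP z zp); case/orP=> [/eqnP zu'|/allP /(_ w wp)].
    by rewrite zu' eqxx in zu.
  case/orP=> [/eqnP wv'|]; first by rewrite wv' eqxx in wv.
  case: (models_adj m zp) (models_adj m wp) => lz _ [lw _].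
  by move/(surely_nonadjP lz lw); rewrite sym ewz.
move=> a b a' b' /RP [p pM [-> ->]] /RP [q qM [-> ->]] e1 e2.
move: (las _ (M_as p pM)) (lbs _ (M_bs p pM)) (las _ (M_as q qM)) (lbs _ (M_bs q qM)).
move=> l1 l2 l3 l4.
(* If the two pairs share their first vertex, [e1] is an edge inside the pair [q], which was checked
   to be absent. *)
case/or3P: (allP (M2 p pM) q qM) => [/eqnP E||].
- move: e1; rewrite E; case/and4P: (M1 q qM) => _ _ na _.
  by rewrite (negbTE (surely_nonadjP l3 l4 na)).
- by move/(surely_nonadjP l1 l4); rewrite e1.
- by move/(surely_nonadjP l3 l2); rewrite e2.
Qed.

Lemma add_edge_models x y : x < size s -> y < size s -> x != y ->
  y \notin adj s x -> x \notin adj s y -> e (f x) (f y) ->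
  models c f (add_edge s x y).
Proof.
move=> lx ly xy yx xy' exy.
have sz : size (add_edge s x y) = size s by rewrite /add_edge /add_arc !size_update.
have nthE z : nth vtx0 (add_edge s x y) z =
    if z == y then add_nbrs [:: x] (nth vtx0 s y)
    else if z == x then add_nbrs [:: y] (nth vtx0 s x) else nth vtx0 s z.
  rewrite /add_edge /add_arc nth_update ?size_update // !nth_update //.
  by rewrite [y == x]eq_sym (negbTE xy).
have adjE z : adj (add_edge s x y) z =
    if z == y then adj s y ++ [:: x] else if z == x then adj s x ++ [:: y] else adj s z.
  by rewrite /adj nthE; case: ifP => // _; case: ifP.
split.
- exact: (models_proper m).
- move=> z; rewrite sz => lz; rewrite (models_colour m lz) /colour nthE.
  by case: eqP => [->|_] //; case: eqP => [->|].
- by rewrite sz; exact: (models_inj m).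
- move=> z w; rewrite sz adjE; case: eqP => [->|_].
    rewrite mem_cat inE; case/orP=> [/(models_adj m) //|/eqP ->].
    by rewrite sym.
  case: eqP => [->|_]; last exact: (models_adj m).
  by rewrite mem_cat inE; case/orP=> [/(models_adj m) //|/eqP ->].
- move=> z; rewrite adjE; case: ifP => _.
    by rewrite cats1 rcons_uniq (models_uniq m) xy'.
  case: ifP => _; last exact: (models_uniq m).
  by rewrite cats1 rcons_uniq (models_uniq m) yx.
- move=> z w; rewrite sz /nonadj nthE => H; apply: (models_nonadj m); move: H.
  by rewrite /nonadj; case: eqP => [->|_] //; case: eqP => [->|].
Qed.

Lemma add_nonedge_models x y : x < size s -> y < size s -> ~~ e (f x) (f y) ->
  models c f (add_nonedge s x y).
Proof.
move=> lx ly exy.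
have sz : size (add_nonedge s x y) = size s by rewrite /add_nonedge size_update.
have adjE z : adj (add_nonedge s x y) z = adj s z.
  by rewrite /adj /add_nonedge nth_update //; case: eqP => [->|].
split.
- exact: (models_proper m).
- move=> z; rewrite sz => lz; rewrite (models_colour m lz) /colour /add_nonedge nth_update //.
  by case: eqP => [->|].
- by rewrite sz; exact: (models_inj m).
- by move=> z w; rewrite sz adjE; exact: (models_adj m).
- by move=> z; rewrite adjE; exact: (models_uniq m).
- move=> z w; rewrite sz /nonadj /add_nonedge nth_update //; case: eqP => [->|_].
    by rewrite inE; case/orP=> [/eqP ->|/(models_nonadj m)].
  exact: (models_nonadj m).
Qed.

(** By the second hypothesis, the neighbours of [f x] not yet named lie outside the image of the
    known vertices, so naming them keeps the realisation injective. *)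
Lemma add_missing_models x : x < size s ->
  (forall y, y < size s -> y \notin adj s x -> ~~ e (f x) (f y)) ->
  exists f', models c f' (add_missing s x).
Proof.
move=> lx nonx; set n := size s; set k := 3 - size (adj s x).
pose N := enum [set t | e (f x) t].
pose r := [seq t <- N | t \notin [seq f y | y <- adj s x]].
have ur : uniq r by rewrite filter_uniq // enum_uniq.
(* The three neighbours of [f x] split into the known ones and those in [r]. *)
have sr : size r = k.
  have /(congr1 (fun i => i - size (adj s x))) : size (adj s x) + size r = 3.
    rewrite -(cub (f x)) cardE -/N -(count_predC (mem [seq f y | y <- adj s x]) N).
    rewrite -[in RHS]size_filter -[X in _ = _ + X]size_filter; congr (_ + _).
    rewrite -(size_map f); apply: perm_size; apply: uniq_perm.
    - exact: map_adj_uniq.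
    - by rewrite filter_uniq // enum_uniq.
    move=> t; rewrite mem_filter /= mem_enum inE.
    apply/idP/idP=> [tx|/andP [] //]; rewrite tx.
    by case/mapP: tx => y /(models_adj m) [_ exy] ->.
  by rewrite addnC addnK.
have rE i : i < k -> e (f x) (nth (f x) r i) /\
    (forall y, y < n -> f y != nth (f x) r i).
  rewrite -sr => /(mem_nth (f x)); rewrite mem_filter mem_enum inE => /andP [nr er].
  split=> // y ly; apply/eqP=> E; move: nr; rewrite -E => nr; rewrite -E in er.
  have: y \notin adj s x by apply: contra nr; exact: map_f.
  by move/(nonx _ ly); rewrite er.
pose f' i := if i < n then f i else nth (f x) r (i - n).
have f'1 i : i < n -> f' i = f i by rewrite /f' => ->.
exists f'.
have sz : size (add_missing s x) = n + k by rewrite /add_missing size_cat size_update size_nseq.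
have nthE z : nth vtx0 (add_missing s x) z =
    if z < n then (if z == x then add_nbrs (iota n k) (nth vtx0 s x) else nth vtx0 s z)
    else if z < n + k then (~~ colour s x, [:: x], [::]) else vtx0.
  rewrite /add_missing nth_cat size_update -/n -/k; case: ltnP => lz.
    by rewrite nth_update.
  by rewrite nth_nseq -(ltn_add2r n) subnK // addnC.
have new i : ~~ (i < n) -> i < n + k -> i - n < k.
  by rewrite -leqNgt => le lt; rewrite -(ltn_add2r n) subnK // addnC.
split.
- exact: (models_proper m).
- move=> z; rewrite sz /colour nthE /f' => lz; case: ifP => [lzn|/negbT nz].
    by rewrite (models_colour m lzn); case: eqP => [->|].
  rewrite lz /=; case: (rE _ (new z nz lz)) => /(models_proper m).
  by rewrite (models_colour m lx); case: (c _) (colour _ _) => [] [].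
- move=> y z; rewrite sz /f' => ly lz; case: ifP => [lyn|/negbT ny]; case: ifP => [lzn|/negbT nz].
  + exact: (models_inj m).
  + by move=> E; case: (rE _ (new z nz lz)) => _ /(_ _ lyn); rewrite E eqxx.
  + by move=> E; case: (rE _ (new y ny ly)) => _ /(_ _ lzn); rewrite E eqxx.
  + move/eqP; rewrite nth_uniq ?sr // ?new // => /eqP /(congr1 (addn n)).
    by rewrite !subnKC // leqNgt.
- move=> y z; rewrite sz /adj nthE; case: ifP => [lyn|/negbT ny].
    have [->|_] := eqVneq y x.
      rewrite /= mem_cat => /orP [/(models_adj m) [lz exz]|].
        by rewrite !f'1 ?ltn_addr.
      rewrite mem_iota => /andP [le lz]; split=> //; rewrite (f'1 x) // /f' ltnNge le /=.
      by have [] := rE (z - n); rewrite // new // -leqNgt.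
    by move=> /(models_adj m) [lz eyz]; rewrite !f'1 ?ltn_addr.
  case: ifP => // lyk; rewrite inE => /eqP ->; split; first exact: ltn_addr.
  rewrite (f'1 x) // sym /f' (negbTE ny).
  by have [] := rE (y - n) (new y ny lyk).
- move=> z; rewrite /adj nthE; case: ifP => [lzn|_]; last by case: ifP.
  case: eqP => _; last exact: (models_uniq m).
  rewrite /= cat_uniq (models_uniq m) iota_uniq andbT /=.
  apply/hasPn=> y; rewrite mem_iota => /andP [le _]; apply/negP=> /(models_adj m) [].
  by rewrite ltnNge le.
- move=> y z; rewrite sz /nonadj nthE; case: ifP => [lyn H|_]; last by case: ifP.
  have/(models_nonadj m) [lz nyz] : z \in nonadj s y.
    by move: H; rewrite /nonadj; case: eqP => [->|].
  by rewrite !f'1 ?ltn_addr.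
Qed.

Lemma embedding_models L b g : embedding_ok L s b g ->
  exists c' f', models c' f' L.
Proof.
case/and4P=> /eqnP sg_ ug /allP gs /allP LP.
exists (fun t => b (+) c t), (fun x => f (nth 0 g x)).
have ls x : x < size L -> nth 0 g x < size s.
  by move=> lx; apply: gs; apply: mem_nth; rewrite sg_.
have xL x : x < size L -> x \in iota 0 (size L) by rewrite mem_iota.
(* Beyond the last vertex the default [vtx0] has empty lists, so nothing is required there. *)
have out x : ~~ (x < size L) -> adj L x = [::] /\ nonadj L x = [::].
  by rewrite -leqNgt => le; rewrite /adj /nonadj nth_default.
split.
- by move=> x y /(models_proper m); apply: contra => /eqP /addbI ->.
- move=> x lx; rewrite (models_colour m (ls x lx)).
  by case/and4P: (LP x (xL x lx)) => /eqP ->.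
- move=> x y lx ly /(models_inj m (ls x lx) (ls y ly)) /eqP.
  by rewrite nth_uniq ?sg_ // => /eqP.
- move=> x y yx; have lx := adj_size yx.
  case/and4P: (LP x (xL x lx)) => _ _ /allP /(_ y yx) /andP [ly]; rewrite memnE.
  by case/(models_adj m).
- move=> x; case: (boolP (x < size L)) => [lx|/out [-> _] //].
  by case/and4P: (LP x (xL x lx)).
- move=> x y yx; have lx := nonadj_size yx.
  case/and4P: (LP x (xL x lx)) => _ _ _ /allP /(_ y yx) /andP [ly na]; split=> //.
  exact: surely_nonadjP (ls x lx) (ls y ly) na.
Qed.

(** The listed vertices induce the target graph, and their set is closed under adjacency; by
    connectedness it is everything. *)
Lemma isomorphism_okP tbl g : connected_graph e -> 0 < size tbl ->
  isomorphism_ok tbl s g -> isomorphic e (table_rel tbl).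
Proof.
move=> [_ conn] tbl0 /and3P [/eqnP sg_ ug /allP gP].
have it (i : 'I_(size tbl)) : val i \in iota 0 (size tbl) by rewrite mem_iota ltn_ord.
pose h (i : 'I_(size tbl)) := f (nth 0 g i).
have ls (i : 'I_(size tbl)) : nth 0 g i < size s by case/and4P: (gP i (it i)).
have hinj : injective h.
  move=> i j /(models_inj m (ls i) (ls j)) /eqP.
  by rewrite nth_uniq ?sg_ // => /eqP /val_inj.
have he i j : e (h i) (h j) = table_rel tbl i j.
  case/and4P: (gP i (it i)) => _ fi _ /allP /(_ _ (it j)) /eqP.
   rewrite /table_rel => <-; rewrite memnE.
  apply/idP/idP=> [|/(models_adj m) [_ //]]; apply: contraTT.
  exact: full_nonadj (ls j) fi.
pose i0 : 'I_(size tbl) := Ordinal tbl0.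
have hsurj t : t \in codom h.
  have cl : closed e (codom h).
    apply: (intro_closed (sym_connect_sym sym)) => t1 t2 e12 /codomP [i E].
    case/and4P: (gP i (it i)) => _ fi /allP gadj _.
    move: e12; rewrite E => /(full_nbr fi) [y yi ->].
    move/gadj: yi; rewrite memnE => yg.
    have lt : index y g < size tbl by rewrite -sg_ index_mem.
    by apply/codomP; exists (Ordinal lt); rewrite /h /= nth_index.
  by rewrite -(closed_connect cl (conn (h i0) t)) codom_f.
exists (fun t => iinv (hsurj t)); split.
  by exists h => [t|i]; [rewrite f_iinv | apply: hinj; rewrite f_iinv].
by move=> x y; rewrite -he !f_iinv.
Qed.

End Model.

Hypotheses (conn : connected_graph e) (irred : B_irreducible e).

(** Each leaf yields [P]: a reduction contradicts irreducibility, an embedding appeals to an earlier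
    state, an identification to a target. Earlier states are assumed for all [c] and [f], since an
    embedding changes both. *)
Lemma check_sound (tbls : seq (seq (seq nat))) (P : Prop) lems t s c f :
  all (fun tbl => 0 < size tbl) tbls ->
  (forall tbl, tbl \in tbls -> isomorphic e (table_rel tbl) -> P) ->
  (forall L c f, L \in lems -> models c f L -> P) ->
  check tbls lems t s -> models c f s -> P.
Proof.
move=> /allP tbl0 tblP lemP; elim: t s c f => /= [x y t1 IH1 t2 IH2|x t IH|u v bs|k b g|k g] s c f.
- case/and5P=> lx ly; rewrite !memnE => yx xy /and3P [/eqnP /eqP nxy ck1 ck2] m.
  have [exy|exy] := boolP (e (f x) (f y)).
    exact: IH1 ck1 (add_edge_models m lx ly nxy yx xy exy).
  exact: IH2 ck2 (add_nonedge_models m lx ly exy).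
- case/and3P=> lx /allP nx ck m.
  have [|f' m'] := add_missing_models m lx; last exact: IH ck m'.
  move=> y ly yx; move: (nx y); rewrite mem_iota memnE (negbTE yx) => /(_ ly).
  exact: (surely_nonadjP m lx ly).
- by move=> ck m; case: (irred (reduction_okP m ck)).
- case/andP=> lk ck m; have [c' [f' m']] := embedding_models m ck.
  by apply: lemP m'; apply: mem_nth.
- case/andP=> lk ck m; apply: (tblP _ (mem_nth [::] lk)).
  by apply: (isomorphism_okP m conn _ ck); apply: tbl0; apply: mem_nth.
Qed.

Lemma check_all_sound (tbls : seq (seq (seq nat))) (P : Prop) lems todo :
  all (fun tbl => 0 < size tbl) tbls ->
  (forall tbl, tbl \in tbls -> isomorphic e (table_rel tbl) -> P) ->
  (forall L c f, L \in lems -> models c f L -> P) ->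
  check_all tbls lems todo ->
  forall s c f, s \in unzip1 todo -> models c f s -> P.
Proof.
move=> tbl0 tblP; elim: todo lems => [|[s0 t] todo IH] lems //= lemP /andP [ck cks].
have s0P c f : models c f s0 -> P by apply: check_sound tbl0 tblP lemP ck.
move=> s c f; rewrite inE => /orP [/eqP -> |]; first exact: s0P.
apply: IH cks s c f => L c f; rewrite mem_rcons inE => /orP [/eqP -> |].
  exact: s0P.
exact: lemP.
Qed.

End Soundness.

(** * Graphs given by adjacency tables *)

(** Both colours flip along each edge, so their sum is constant on a connected graph. This compares
    the arbitrary colouring in [B_reducible] with the parity colouring of a table. *)
Lemma proper2col_agree (T : finType) (e : rel T) c c' x y :
  connected_graph e -> simple_graph e -> proper2col e c -> proper2col e c' ->
  c x (+) c' x = c y (+) c' y.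
Proof.
move=> [_ conn] [sym _] col col'.
have cl : closed e [pred z | c x (+) c' x == c z (+) c' z].
  apply: (intro_closed (sym_connect_sym sym)) => z w ezw; rewrite !inE => /eqP ->.
  by move: (col _ _ ezw) (col' _ _ ezw); case: (c z) (c w) (c' z) (c' w) => [] [] [] [].
by have := closed_connect cl (conn x y); rewrite !inE eqxx => /esym /eqP.
Qed.

Section Tables.
Variable tbl : seq (seq nat).
Local Notation n := (size tbl).
Local Notation nbr := (nth [::] tbl).

(** Tailored to the two LCF graphs: the order is even and the shifts are odd, so parity of labels is
    a proper colouring, and the edges between consecutive labels form a Hamiltonian path, which
    gives connectedness. The nested [all] excludes 4-cycles. *)
Definition table_ok : bool :=
  (0 < n) &&
  all (fun x => [&& eqn (size (nbr x)) 3, uniq (nbr x),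
    all (fun y => [&& y < n, memn x (nbr y), odd x (+) odd y &
      all (fun z => eqn z x || all (fun w => eqn w y || ~~ memn x (nbr w)) (nbr z)) (nbr y)])
      (nbr x) &
    (x.+1 < n) ==> memn x.+1 (nbr x)]) (iota 0 n).

(** Matching [a] with [b] would create a double edge in the first case and a 4-cycle in the
    second. *)
Definition spoiled_pair u v a b : bool :=
  memn b (nbr a) ||
  has (fun x => ~~ eqn x u && has (fun y => ~~ eqn y v && memn b (nbr y)) (nbr x)) (nbr a).

(* If some pair (a, b) could be matched, then some other neighbour a' of u has
   only partners b' for which a'b' is spoiled or a, b', a', b close a 4-cycle. *)
Definition table_irreducible : bool :=
  all (fun u => all (fun v => (odd u (+) odd v) ==>
    all (fun a => eqn a v || all (fun b => [|| eqn b u, spoiled_pair u v a b |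
      has (fun a' => [&& ~~ eqn a' v, ~~ eqn a' a &
        all (fun b' => [|| eqn b' u, eqn b' b, spoiled_pair u v a' b' |
                           memn b' (nbr a) && memn b (nbr a')]) (nbr v)])
        (nbr u)]) (nbr v)) (nbr u))
    (iota 0 n)) (iota 0 n).

Hypothesis ok : table_ok.

(** With a bijective labelling [F] of an arbitrary graph, the results below cover the target itself
    and all its isomorphic copies. *)
Variables (T : finType) (e : rel T) (F : T -> nat).
Hypotheses (Finj : injective F) (Flt : forall t, F t < n).
Hypotheses (Fsurj : forall i, i < n -> exists t, F t = i).
Hypothesis eE : forall x y, e x y = memn (F y) (nbr (F x)).

Let okP x : x < n -> [&& eqn (size (nbr x)) 3, uniq (nbr x),
    all (fun y => [&& y < n, memn x (nbr y), odd x (+) odd y &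
      all (fun z => eqn z x || all (fun w => eqn w y || ~~ memn x (nbr w)) (nbr z)) (nbr y)])
      (nbr x) &
    (x.+1 < n) ==> memn x.+1 (nbr x)].
Proof. by case/andP: ok => _ /allP H lx; apply: H; rewrite mem_iota. Qed.

Let nbrP x y : e x y -> [&& F y < n, memn (F x) (nbr (F y)), odd (F x) (+) odd (F y) &
      all (fun z => eqn z (F x) ||
        all (fun w => eqn w (F y) || ~~ memn (F x) (nbr w)) (nbr z)) (nbr (F y))].
Proof.
by rewrite eE memnE; case/and4P: (okP (Flt x)) => _ _ /allP H _; exact: H.
Qed.

Lemma table_sym : symmetric e.
Proof. by move=> x y; apply/idP/idP=> /nbrP /and4P [_]; rewrite -eE. Qed.

Lemma table_col : proper2col e (fun x => odd (F x)).
Proof. by move=> x y /nbrP /and4P [_ _]; case: (odd _) (odd _) => [] []. Qed.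

Lemma table_nbr x k : k \in nbr (F x) -> exists2 y, F y = k & e x y.
Proof.
move=> kx; case/and4P: (okP (Flt x)) => _ _ /allP /(_ k kx) /and4P [lk _ _ _] _.
by have [y Fy] := Fsurj lk; exists y; rewrite // eE Fy memnE.
Qed.

Lemma table_simple : simple_graph e.
Proof.
split; first exact: table_sym.
by move=> x; apply/negP=> /table_col; rewrite eqxx.
Qed.

Lemma table_cubic : cubic e.
Proof.
move=> x; case/and4P: (okP (Flt x)) => /eqnP <- ux _ _.
rewrite cardE -(size_map F); apply: perm_size; apply: uniq_perm => //.
  by rewrite map_inj_uniq // enum_uniq.
move=> k; apply/mapP/idP=> [[y]|/table_nbr [y <- exy]].
  by rewrite mem_enum inE eE memnE => ? ->.
by exists y; rewrite // mem_enum inE.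
Qed.

Lemma table_v3 : v3_graph e.
Proof.
split; [exact: table_simple | exact: table_cubic | by exists (fun x => odd (F x)); exact: table_col |].
apply: (no_C4_girth_ge6 table_col) => x y z w exy; rewrite !eE !memnE => zy wz xw xz yw.
case/and4P: (nbrP exy) => _ _ _ /allP /(_ _ zy) /orP [/eqnP /Finj zx|].
  by rewrite zx eqxx in xz.
move/allP=> /(_ _ wz) /orP [/eqnP /Finj wy|]; first by rewrite wy eqxx in yw.
by rewrite memnE xw.
Qed.

Lemma table_connected : connected_graph e.
Proof.
have [t0 F0] : exists t, F t = 0 by apply: Fsurj; case/andP: ok.
have c0 k t : F t = k -> connect e t0 t.
  elim: k t => [|k IH] t Ft; first by rewrite (Finj (etrans F0 (esym Ft))) connect0.
  have lk : k.+1 < n by rewrite -Ft.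
  have [y Fy] := Fsurj (ltnW lk).
  apply: connect_trans (IH _ Fy) (connect1 _); rewrite eE Fy Ft.
  by case/and4P: (okP (ltnW lk)) => _ _ _; rewrite lk.
split; first by exists t0.
move=> x y; apply: (connect_trans (y := t0)); last exact: c0.
by rewrite (sym_connect_sym table_sym); apply: c0.
Qed.

Lemma spoiled_pairP u v a b : spoiled_pair (F u) (F v) (F a) (F b) ->
  e a b \/ exists x y, [/\ e a x, x != u, e x y, y != v & e y b].
Proof.
case/orP=> [|/hasP [i ia /andP [iu /hasP [j ji /andP [jv bj]]]]]; first by rewrite -eE; left.
right; have [x Fx eax] := table_nbr ia; rewrite -Fx in iu ji.
have [y Fy exy] := table_nbr ji; rewrite -Fy in jv bj.
exists x, y; split=> //; last by rewrite eE.
  by apply: contra iu => /eqP ->; apply/eqnP.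
by apply: contra jv => /eqP ->; apply/eqnP.
Qed.

(** A successful reduction matches only unspoiled pairs. Starting from one of them, the table
    provides a second neighbour of [u] whose partner is then forced to close a 4-cycle. *)
Lemma table_B_irreducible : table_irreducible -> B_irreducible e.
Proof.
move=> irr [c [colc [u [v [M [cu cv [hM hM1 hM2] new v3R]]]]]].
have [sym irrefl] := table_simple.
(* The table test is restricted to labels of opposite parity, whereas [u] and [v] are opposite for
   [c]. *)
have colR : odd (F u) (+) odd (F v).
  have := proper2col_agree u v table_connected table_simple colc table_col.
  by rewrite cu (negbTE cv); case: (odd _) (odd _) => [] [].
have uv : u != v by apply/eqP=> E; move: cv; rewrite -E cu.
have noC4 (x y z w : red_vertex u v) : red_rel e u v M x y -> red_rel e u v M y z ->
    red_rel e u v M z w -> red_rel e u v M w x -> x != z -> y != w -> False.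
  by case: v3R => sgR _ _ gR; exact: girth_ge6_no_C4 sgR gR.
have RVM a b : M a b -> [/\ a != u, a != v, b != u & b != v].
  case/hM/and4P=> eua av evb bu; split=> //.
    by apply: contraTneq eua => ->; rewrite irrefl.
  by apply: contraTneq evb => ->; rewrite irrefl.
have cL a b : M a b -> c a = false.
  by case/hM/and4P=> /colc; rewrite cu; case: (c a).
have cR a b : M a b -> c b.
  by case/hM/and4P=> _ _ /colc; rewrite (negbTE cv); case: (c b).
have unspoiled a b : M a b -> spoiled_pair (F u) (F v) (F a) (F b) -> False.
  move=> Mab /spoiled_pairP [eab|[x [y [eax xu exy yv eyb]]]].
    by move: (new _ _ Mab); rewrite eab.
  have ab : ~~ e a b := new _ _ Mab.
  have [au av bu bv] := RVM _ _ Mab.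
  have cx : c x by move: (colc _ _ eax); rewrite (cL _ _ Mab); case: (c x).
  have cy : c y = false by move: (colc _ _ exy); rewrite cx; case: (c y).
  have xv : x != v by apply: contraNneq cv => <-.
  have yu : y != u by apply: contraTneq cu => <-; rewrite cy.
  have aP : (a != u) && (a != v) by rewrite au.
  have bP : (b != u) && (b != v) by rewrite bu.
  have xP : (x != u) && (x != v) by rewrite xu.
  have yP : (y != u) && (y != v) by rewrite yu.
  apply: (noC4 (Sub a aP) (Sub x xP) (Sub y yP) (Sub b bP)); rewrite /red_rel ?SubK.
  - by rewrite eax.
  - by rewrite exy.
  - by rewrite eyb.
  - by rewrite Mab !orbT.
  - by rewrite -val_eqE !SubK; apply: contraNneq ab => ->.
  - by rewrite -val_eqE !SubK; apply: contraNneq ab => <-.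
have partner a : e u a -> a != v -> exists b, M a b.
  move=> eua av; move/eqP: (hM1 a eua av) => /cards1P [b /setP /(_ b)].
  by rewrite !inE eqxx => Mab; exists b.
(* At most one of the three neighbours of [u] is [v]. *)
have [a /andP [av eua]] : exists a, (a != v) && e u a.
  have : 0 < #|[set y | e u y] :\ v|.
    have := table_cubic u; rewrite (cardsD1 v); case: (v \in _) => //=.
      by rewrite add1n; case=> ->.
    by rewrite add0n => ->.
  by case/card_gt0P=> a; rewrite !inE => H; exists a.
have [b Mab] := partner a eua av.
have [_ _ bu bv] := RVM _ _ Mab; have /and4P [_ _ evb _] := hM _ _ Mab.
have lu : F u \in iota 0 n by rewrite mem_iota Flt.
have lv : F v \in iota 0 n by rewrite mem_iota Flt.
have nb x y : e x y -> F y \in nbr (F x) by rewrite eE memnE.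
have neF x y : x != y -> eqn (F x) (F y) = false.
  by move=> xy; apply/eqP=> /Finj /eqP; rewrite (negbTE xy).
have := allP (allP irr _ lu) _ lv; rewrite colR /=.
move/allP/(_ _ (nb _ _ eua)); rewrite (neF _ _ av) /=.
move/allP/(_ _ (nb _ _ evb)); rewrite (neF _ _ bu) /=.
case/orP=> [/(unspoiled _ _ Mab) //|/hasP [k ku]].
have [a' Fa' eua'] := table_nbr ku; rewrite -Fa'.
case/and3P=> /eqnP a'v /eqnP a'a.
have {}a'v : a' != v by apply/eqP=> E; apply: a'v; rewrite E.
have {}a'a : a' != a by apply/eqP=> E; apply: a'a; rewrite E.
have [b' Mab'] := partner a' eua' a'v.
have [a'u _ b'u b'v] := RVM _ _ Mab'; have /and4P [_ _ evb' _] := hM _ _ Mab'.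
have b'b : b' != b.
  apply/eqP=> E; rewrite E in Mab'.
  move/eqP: (hM2 b evb bu) => /cards1P [t /setP st].
  move: (st a) (st a'); rewrite !inE Mab Mab' => /esym /eqP <- /esym.
  by rewrite (negbTE a'a).
move/allP/(_ _ (nb _ _ evb')); rewrite (neF _ _ b'u) (neF _ _ b'b) /=.
case/orP=> [/(unspoiled _ _ Mab') //|]; rewrite -!eE => /andP [eab' ea'b].
have [au _ _ _] := RVM _ _ Mab.
have aP : (a != u) && (a != v) by rewrite au.
have bP : (b != u) && (b != v) by rewrite bu.
have a'P : (a' != u) && (a' != v) by rewrite a'u.
have b'P : (b' != u) && (b' != v) by rewrite b'u.
(* The edges of this 4-cycle are alternately matched and old. *)
apply: (noC4 (Sub a aP) (Sub b bP) (Sub a' a'P) (Sub b' b'P)); rewrite /red_rel ?SubK.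
- by rewrite Mab !orbT.
- by rewrite sym ea'b.
- by rewrite Mab' !orbT.
- by rewrite sym eab'.
- by rewrite -val_eqE !SubK eq_sym.
- by rewrite -val_eqE !SubK eq_sym.
Qed.

End Tables.

(* [lcf_graph] on bare natural numbers, to which it is convertible, so that its
   adjacency can be tabulated by computation. *)
Definition lcf_adj (n : nat) (L : seq int) (x y : nat) : bool :=
  (let step (a : nat) (d : int) (b : nat) := b%:Z == ((a%:Z + d) %% n%:Z)%Z in
   [|| step x 1 y, step y 1 x, step x (nth 0 L (x %% size L)%N) y
     | step y (nth 0 L (y %% size L)%N) x])%R.

Definition lcf_table n L := [seq [seq y <- iota 0 n | lcf_adj n L x y] | x <- iota 0 n].

Lemma lcf_tableE n L (x y : 'I_n) :
  lcf_graph n L x y = memn y (nth [::] (lcf_table n L) x).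
Proof.
rewrite (nth_map 0) ?size_iota // nth_iota // add0n memnE mem_filter mem_iota.
by rewrite add0n ltn_ord !andbT.
Qed.

Definition heawood_table : seq (seq nat) :=
  Eval vm_compute in lcf_table 14 [:: 5; -5]%R.

Definition pappus_table : seq (seq nat) :=
  Eval vm_compute in lcf_table 18 [:: 5; 7; -7; 7; -7; -5]%R.

Lemma heawood_tableE (x y : 'I_14) : heawood x y = memn y (nth [::] heawood_table x).
Proof.
have <- : lcf_table 14 [:: 5; -5]%R = heawood_table by vm_compute.
exact: lcf_tableE.
Qed.

Lemma pappus_tableE (x y : 'I_18) : pappus x y = memn y (nth [::] pappus_table x).
Proof.
have <- : lcf_table 18 [:: 5; 7; -7; 7; -7; -5]%R = pappus_table by vm_compute.
exact: lcf_tableE.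
Qed.

Lemma heawood_table_ok : table_ok heawood_table && table_irreducible heawood_table.
Proof. by vm_compute. Qed.

Lemma pappus_table_ok : table_ok pappus_table && table_irreducible pappus_table.
Proof. by vm_compute. Qed.

Section LabelledByTable.
Variables (tbl : seq (seq nat)) (g : rel 'I_(size tbl)).
Hypotheses (ok : table_ok tbl && table_irreducible tbl).
Hypothesis gE : forall x y, g x y = memn y (nth [::] tbl x).

Lemma table_target : v3_graph g /\ connected_graph g.
Proof.
case/andP: ok => tok _.
have surj i : i < size tbl -> exists t : 'I_(size tbl), val t = i.
  by move=> li; exists (Ordinal li).
split.
  by apply: (@table_v3 tbl tok _ g val) => //; [exact: val_inj | move=> t; exact: ltn_ord].
by apply: (@table_connected tbl tok _ g val) => //; [exact: val_inj | move=> t; exact: ltn_ord].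
Qed.

(** No reduction is transported along the isomorphism: it labels [e] by the table directly. *)
Lemma isomorphic_B_irreducible (T : finType) (e : rel T) :
  isomorphic e g -> B_irreducible e.
Proof.
case/andP: ok => tok tirr [f [[h fK hK] fe]].
apply: (@table_B_irreducible tbl tok _ e (fun t => val (f t))) => //.
- by move=> x y /val_inj /(can_inj fK).
- by move=> t; exact: ltn_ord.
- by move=> i li; exists (h (Ordinal li)); rewrite hK.
- by move=> x y; rewrite -fe gE.
Qed.

End LabelledByTable.

(** * The case tree *)

Definition mkstate (cols : seq bool) (es ns : seq (nat * nat)) : state :=
  foldl (fun s p => add_nonedge s p.1 p.2)
    (foldl (fun s p => add_edge s p.1 p.2) [seq (b, [::], [::]) | b <- cols] es) ns.

(** Best read from the end. In state 19, a single vertex, an edge on no hexagon gives a reduction by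
    its two ends. State 18 has a hexagon through the edge 0 1; the other matching then fails only if
    a second hexagon produces state 6 or 17. The graphs are identified in state 3 (Heawood) and
    state 7 (Pappus). *)
Definition certificates : seq (state * cert) := [::
(mkstate [:: false; true; false; true; true; false; true; false; false; true; false; true; false;
true; false; true] [:: (0,1); (0,4); (0,6); (1,2); (1,8); (2,3); (2,9); (3,5); (3,7); (4,5);
(4,10); (5,11); (6,7); (6,12); (7,13); (8,11); (8,13); (9,10); (9,12); (10,13); (11,14); (12,15)]
[::],
Branch 14 15 (Fill 14 (Fill 16 (Fill 15 (Reduce 14 6 [:: 12; 0; 7])))) (Fill 14 (Fill 16 (Fill 17
(Reduce 14 6 [:: 12; 0; 7])))));
(mkstate [:: false; true; false; true; true; false; true; false; false; true; false; true; false;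
true; true] [:: (0,1); (0,4); (0,6); (1,2); (1,8); (2,3); (2,9); (3,5); (3,7); (4,5); (4,10);
(5,11); (6,7); (6,12); (7,13); (8,13); (8,14); (9,10); (9,12)] [::],
Branch 11 12 (Fill 11 (Branch 10 13 (Embed 0 false [:: 0; 4; 10; 9; 6; 12; 1; 2; 5; 13; 7; 11; 8;
3; 15; 14]) (Branch 10 14 (Branch 13 15 (Fill 14 (Fill 15 (Reduce 8 13 [:: 15; 7]))) (Fill 13
(Fill 16 (Branch 14 15 (Reduce 8 13 [:: 16; 7]) (Fill 14 (Reduce 8 13 [:: 16; 7])))))) (Branch 13
15 (Fill 14 (Fill 15 (Reduce 8 13 [:: 15; 7]))) (Fill 13 (Branch 14 15 (Fill 16 (Fill 14 (Reduce 8
13 [:: 16; 7]))) (Fill 14 (Fill 16 (Reduce 8 13 [:: 16; 7]))))))))) (Fill 11 (Branch 13 15 (Fill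
15 (Branch 16 14 (Fill 16 (Branch 10 17 (Reduce 7 11 [:: 16; 15; 5]) (Reduce 5 11 [:: 16; 15])))
(Fill 16 (Branch 12 17 (Reduce 5 11 [:: 16; 15]) (Reduce 7 11 [:: 16; 15; 5]))))) (Branch 13 16
(Fill 16 (Branch 10 17 (Fill 17 (Reduce 16 3 [:: 2; 5; 7])) (Branch 12 17 (Fill 17 (Branch 10 14
(Branch 14 15 (Reduce 8 13 [:: 16; 7]) (Branch 14 18 (Reduce 8 13 [:: 16; 7]) (Fill 14 (Reduce 8
13 [:: 16; 7])))) (Fill 10 (Reduce 16 4 [:: 0; 10; 5])))) (Fill 17 (Reduce 16 3 [:: 2; 5; 7])))))
(Branch 15 14 (Fill 16 (Fill 15 (Branch 10 19 (Reduce 5 11 [:: 15; 16]) (Branch 10 14 (Reduce 5 11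
[:: 15; 16]) (Reduce 5 11 [:: 16; 15]))))) (Fill 15 (Branch 16 14 (Fill 16 (Branch 10 14 (Reduce 5
11 [:: 16; 15]) (Branch 10 19 (Reduce 5 11 [:: 16; 15]) (Reduce 5 11 [:: 15; 16])))) (Fill 16
(Branch 10 17 (Reduce 5 11 [:: 15; 16]) (Branch 10 18 (Reduce 5 11 [:: 15; 16]) (Reduce 5 11 [::
16; 15])))))))))));
(mkstate [:: false; true; false; true; true; false; true; false; false; true; false; true; false;
true] [:: (0,1); (0,4); (0,6); (1,2); (1,8); (2,3); (2,9); (3,5); (3,7); (4,5); (4,10); (5,11);
(6,7); (6,12); (7,13); (8,13); (9,10); (9,12)] [:: (8,11)],
Fill 8 (Embed 1 false [:: 0; 1; 2; 3; 4; 5; 6; 7; 8; 9; 10; 11; 12; 13; 14]));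
(mkstate [:: false; true; false; true; true; false; true; false; false; true; false; true; false;
true] [:: (0,1); (0,4); (0,6); (1,2); (1,8); (2,3); (2,9); (3,5); (3,7); (4,5); (4,10); (5,11);
(6,7); (6,12); (7,13); (8,13); (9,10); (9,12)] [::],
Branch 8 11 (Branch 10 13 (Branch 11 12 (Identify 0 [:: 0; 1; 2; 9; 12; 6; 7; 3; 5; 11; 8; 13; 10;
4]) (Fill 11 (Fill 12 (Embed 0 false [:: 0; 1; 2; 3; 4; 5; 6; 7; 8; 9; 10; 11; 12; 13; 14; 15]))))
(Fill 10 (Fill 13 (Branch 11 12 (Embed 0 false [:: 0; 1; 2; 3; 6; 7; 4; 5; 8; 9; 12; 13; 10; 11;
15; 14]) (Fill 11 (Branch 14 15 (Branch 14 16 (Fill 15 (Fill 16 (Reduce 5 14 [:: 16; 15; 10])))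
(Fill 14 (Fill 17 (Fill 15 (Reduce 5 14 [:: 17; 15; 10]))))) (Branch 14 16 (Fill 14 (Fill 17 (Fill
16 (Reduce 5 14 [:: 16; 17; 10])))) (Fill 14 (Fill 17 (Fill 18 (Reduce 5 14 [:: 18; 17;
10]))))))))))) (Embed 2 false [:: 0; 1; 2; 3; 4; 5; 6; 7; 8; 9; 10; 11; 12; 13]));
(mkstate [:: false; true; false; true; true; false; true; false; false; true; false; true; false;
true] [:: (0,1); (0,4); (0,6); (1,2); (1,8); (2,3); (2,9); (3,5); (3,7); (4,5); (4,10); (5,11);
(6,7); (6,12); (7,13); (9,10); (9,12)] [:: (8,13)],
Branch 8 11 (Embed 2 false [:: 0; 1; 2; 3; 6; 7; 4; 5; 8; 9; 12; 13; 10; 11]) (Fill 8 (Branch 12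
15 (Embed 1 false [:: 2; 1; 0; 6; 3; 7; 9; 12; 8; 4; 5; 13; 10; 15; 14]) (Branch 12 14 (Embed 1
false [:: 2; 1; 0; 6; 3; 7; 9; 12; 8; 4; 5; 13; 10; 14; 15]) (Branch 10 14 (Embed 1 false [:: 2;
1; 0; 4; 3; 5; 9; 10; 8; 6; 7; 11; 12; 14; 15]) (Fill 14 (Branch 10 15 (Embed 1 false [:: 2; 1; 0;
4; 3; 5; 9; 10; 8; 6; 7; 11; 12; 15; 14]) (Fill 15 (Reduce 8 1 [:: 0; 2])))))))));
(mkstate [:: false; true; false; true; true; false; true; false; false; true; false; true; false;
true] [:: (0,1); (0,4); (0,6); (1,2); (1,8); (2,3); (2,9); (3,5); (3,7); (4,5); (4,10); (5,11);
(6,7); (6,12); (7,13); (9,12)] [::],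
Branch 8 13 (Branch 9 10 (Embed 3 false [:: 0; 1; 2; 3; 4; 5; 6; 7; 8; 9; 10; 11; 12; 13]) (Branch
10 13 (Embed 3 false [:: 0; 6; 7; 3; 4; 5; 1; 2; 12; 13; 10; 11; 8; 9]) (Fill 10 (Branch 8 11
(Embed 2 true [:: 3; 2; 1; 0; 5; 4; 7; 6; 9; 8; 11; 10; 13; 12]) (Branch 11 12 (Embed 2 true [::
3; 7; 6; 0; 5; 4; 2; 1; 13; 12; 11; 10; 9; 8]) (Fill 11 (Reduce 5 4 [:: 10; 0]))))))) (Branch 9 10
(Embed 4 false [:: 0; 1; 2; 3; 4; 5; 6; 7; 8; 9; 10; 11; 12; 13]) (Branch 11 12 (Embed 4 true [::
3; 7; 6; 0; 5; 4; 2; 1; 13; 12; 11; 10; 9; 8]) (Reduce 0 3 [:: 7; 2; 5]))));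
(mkstate [:: false; true; false; true; true; false; true; false] [:: (0,1); (0,4); (0,6); (1,2);
(2,3); (3,5); (3,7); (4,5); (6,7)] [::],
Fill 1 (Fill 2 (Fill 4 (Fill 5 (Fill 6 (Fill 7 (Branch 9 12 (Embed 5 false [:: 0; 1; 2; 3; 4; 5;
6; 7; 8; 9; 10; 11; 12; 13]) (Branch 8 11 (Embed 5 false [:: 0; 4; 5; 3; 6; 7; 1; 2; 10; 11; 12;
13; 8; 9]) (Branch 10 13 (Embed 5 false [:: 0; 6; 7; 3; 1; 2; 4; 5; 12; 13; 8; 9; 10; 11]) (Reduce
0 3 [:: 5; 7; 2]))))))))));
(mkstate [:: false; true; false; true; true; true; true; false; false; false; false; false; true;
true; true; false; true; false] [:: (0,1); (0,5); (0,6); (1,2); (1,9); (2,3); (2,4); (3,7);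
(3,10); (4,8); (4,11); (5,7); (5,15); (6,8); (6,17); (7,12); (8,14); (9,13); (9,16); (10,13);
(10,14); (11,12); (11,16); (12,17); (14,15); (15,16)] [::],
Branch 13 17 (Identify 1 [:: 0; 1; 9; 16; 15; 5; 7; 3; 2; 4; 11; 12; 17; 13; 10; 14; 8; 6]) (Fill
13 (Fill 18 (Branch 19 17 (Fill 19 (Fill 21 (Reduce 0 19 [:: 17; 18; 21]))) (Fill 19 (Branch 20 17
(Fill 20 (Reduce 18 1 [:: 0; 9; 2])) (Fill 20 (Reduce 18 1 [:: 0; 2; 9]))))))));
(mkstate [:: false; true; false; true; true; true; true; false; false; false; false; false; true;
true; true; false; true; false] [:: (0,1); (0,5); (0,6); (1,2); (1,9); (2,3); (2,4); (3,7);
(3,10); (4,8); (4,11); (5,7); (5,15); (6,8); (7,12); (8,14); (9,13); (9,16); (10,13); (10,14);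
(11,12); (11,16); (12,17); (14,15); (15,16)] [:: (6,17)],
Branch 17 13 (Embed 7 true [:: 1; 9; 16; 11; 15; 2; 0; 4; 5; 13; 12; 14; 8; 17; 7; 3; 10; 6])
(Fill 17 (Fill 19 (Fill 18 (Reduce 17 3 [:: 10; 2; 7])))));
(mkstate [:: false; true; false; true; true; true; true; false; false; false; false; false; true;
true; true; false; true] [:: (0,1); (0,5); (0,6); (1,2); (1,9); (2,3); (2,4); (3,7); (3,10);
(4,8); (4,11); (5,7); (5,15); (6,8); (7,12); (9,13); (9,16); (10,13); (10,14); (11,16); (14,15);
(15,16)] [::],
Branch 11 12 (Fill 12 (Branch 8 14 (Branch 6 17 (Embed 7 false [:: 0; 1; 2; 3; 4; 5; 6; 7; 8; 9;
10; 11; 12; 13; 14; 15; 16; 17]) (Embed 8 false [:: 0; 1; 2; 3; 4; 5; 6; 7; 8; 9; 10; 11; 12; 13;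
14; 15; 16; 17])) (Branch 13 17 (Branch 6 17 (Embed 7 false [:: 0; 5; 7; 3; 12; 1; 6; 2; 17; 15;
10; 11; 4; 14; 13; 9; 16; 8]) (Reduce 11 5 [:: 15; 7; 0])) (Reduce 11 16 [:: 15; 9])))) (Branch 8
14 (Fill 6 (Branch 13 17 (Embed 8 true [:: 4; 8; 14; 10; 15; 2; 11; 3; 16; 6; 13; 5; 7; 17; 9; 1;
0; 12]) (Reduce 8 3 [:: 7; 10; 2]))) (Fill 14 (Reduce 15 3 [:: 10; 2; 7]))));
(mkstate [:: false; true; false; true; true; true; true; false; false; false; false; false; true;
true; true; false; true] [:: (0,1); (0,5); (0,6); (1,2); (1,9); (2,3); (2,4); (3,7); (3,10);
(4,8); (4,11); (5,7); (5,15); (6,8); (7,12); (9,13); (9,16); (10,13); (10,14); (14,15); (15,16)]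
[:: (5,11)],
Branch 8 16 (Embed 6 false [:: 0; 1; 9; 16; 5; 15; 6; 8]) (Branch 11 16 (Embed 9 false [:: 0; 1;
2; 3; 4; 5; 6; 7; 8; 9; 10; 11; 12; 13; 14; 15; 16]) (Fill 16 (Branch 8 13 (Reduce 2 13 [:: 10; 8;
9]) (Branch 11 13 (Reduce 9 1 [:: 0; 2]) (Fill 13 (Branch 6 18 (Embed 9 false [:: 2; 1; 0; 5; 6;
3; 4; 7; 8; 9; 15; 18; 12; 16; 14; 10; 13]) (Reduce 9 1 [:: 0; 2]))))))));
(mkstate [:: false; true; false; true; true; true; true; false; false; false; false; false; true;
true; true; false; true; false] [:: (0,1); (0,5); (0,6); (1,2); (1,9); (2,3); (2,4); (3,7);
(3,10); (4,8); (4,11); (5,7); (5,15); (6,8); (7,12); (8,12); (9,13); (10,13); (10,14); (12,17);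
(13,17); (14,15); (15,16)] [:: (9,16)],
Fill 9 (Branch 11 14 (Fill 6 (Branch 16 17 (Reduce 0 13 [:: 17; 9; 10]) (Fill 17 (Reduce 0 13 [::
17; 9; 10])))) (Fill 14 (Reduce 10 1 [:: 9; 0; 2]))));
(mkstate [:: false; true; false; true; true; true; true; false; false; false; false; false; true;
true; true; false; true] [:: (0,1); (0,5); (0,6); (1,2); (1,9); (2,3); (2,4); (3,7); (3,10);
(4,8); (4,11); (5,7); (5,15); (6,8); (7,12); (9,13); (10,13); (10,14); (14,15); (15,16)] [::
(5,11); (9,12)],
Branch 9 16 (Embed 10 false [:: 0; 1; 2; 3; 4; 5; 6; 7; 8; 9; 10; 11; 12; 13; 14; 15; 16]) (Branch
11 12 (Fill 6 (Branch 12 17 (Embed 10 true [:: 1; 2; 3; 7; 10; 0; 9; 5; 13; 4; 12; 14; 15; 11; 17;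
6; 8]) (Reduce 0 5 [:: 15; 7]))) (Branch 8 12 (Branch 11 13 (Embed 6 false [:: 2; 1; 9; 13; 3; 10;
4; 11]) (Fill 13 (Branch 12 17 (Embed 11 false [:: 0; 1; 2; 3; 4; 5; 6; 7; 8; 9; 10; 11; 12; 13;
14; 15; 16; 17]) (Branch 11 14 (Reduce 10 5 [:: 15; 7; 0]) (Fill 14 (Reduce 10 3 [:: 7; 2]))))))
(Reduce 2 5 [:: 15; 0; 7]))));
(mkstate [:: false; true; false; true; true; true; true; false; false; false; false; false; true;
true; true; false] [:: (0,1); (0,5); (0,6); (1,2); (1,9); (2,3); (2,4); (3,7); (3,10); (4,8);
(4,11); (5,7); (5,15); (6,8); (7,12); (9,13); (10,13); (10,14); (14,15)] [:: (5,11); (9,12)],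
Fill 15 (Embed 12 false [:: 0; 1; 2; 3; 4; 5; 6; 7; 8; 9; 10; 11; 12; 13; 14; 15; 16]));
(mkstate [:: false; true; false; true; true; true; true; false; false; false; false; false; true;
true; true; false; false] [:: (0,1); (0,5); (0,6); (1,2); (1,9); (2,3); (2,4); (3,7); (3,10);
(4,8); (4,11); (5,7); (5,15); (6,8); (7,12); (8,12); (9,13); (10,13); (10,14); (11,14); (14,16)]
[:: (5,11); (6,10); (9,12); (14,15)],
Fill 11 (Branch 12 16 (Fill 16 (Fill 6 (Branch 15 17 (Branch 9 17 (Embed 11 false [:: 7; 5; 0; 1;
6; 3; 12; 2; 8; 15; 9; 19; 4; 17; 13; 10; 14; 11]) (Branch 17 19 (Branch 9 18 (Reduce 11 1 [:: 9;
0; 2]) (Fill 9 (Reduce 11 1 [:: 9; 0; 2]))) (Fill 17 (Branch 9 18 (Reduce 11 1 [:: 9; 0; 2]) (Fill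
9 (Reduce 11 1 [:: 9; 0; 2])))))) (Branch 9 18 (Branch 18 15 (Reduce 16 1 [:: 0; 9; 2]) (Branch 18
19 (Reduce 16 1 [:: 0; 9; 2]) (Fill 18 (Reduce 16 1 [:: 0; 9; 2])))) (Branch 13 19 (Branch 19 17
(Reduce 10 6 [:: 19; 8; 0]) (Branch 19 18 (Reduce 10 6 [:: 19; 8; 0]) (Fill 19 (Reduce 10 6 [::
19; 8; 0])))) (Reduce 0 14 [:: 16; 11; 10])))))) (Branch 9 17 (Fill 12 (Branch 15 17 (Embed 13
false [:: 7; 3; 2; 1; 4; 5; 12; 0; 8; 10; 9; 11; 6; 13; 17; 15]) (Branch 13 18 (Embed 11 false [::
8; 12; 7; 3; 5; 4; 6; 2; 0; 18; 10; 15; 1; 13; 14; 11; 17; 9]) (Branch 6 16 (Embed 11 false [:: 0;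
6; 8; 4; 12; 1; 5; 2; 7; 16; 11; 18; 3; 14; 17; 9; 13; 10]) (Fill 16 (Reduce 7 14 [:: 16; 11;
10])))))) (Branch 6 16 (Embed 13 false [:: 10; 3; 2; 4; 1; 14; 13; 11; 9; 7; 8; 0; 17; 12; 6; 16])
(Fill 16 (Reduce 2 14 [:: 11; 16; 10]))))));
(mkstate [:: false; true; false; true; true; true; true; false; false; false; false; false; true;
true; true] [:: (0,1); (0,5); (0,6); (1,2); (1,9); (2,3); (2,4); (3,7); (3,10); (4,8); (4,11);
(5,7); (6,8); (7,12); (9,13); (10,13); (10,14)] [:: (6,10); (9,12)],
Branch 5 11 (Embed 6 false [:: 0; 1; 2; 4; 5; 11; 6; 8]) (Fill 5 (Branch 14 15 (Embed 13 false [::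
0; 1; 2; 3; 4; 5; 6; 7; 8; 9; 10; 11; 12; 13; 14; 15]) (Branch 11 12 (Fill 6 (Branch 13 15 (Embed
12 true [:: 5; 7; 3; 2; 10; 0; 15; 1; 13; 12; 4; 14; 9; 11; 8; 6; 16]) (Fill 15 (Branch 12 16
(Embed 10 true [:: 1; 2; 3; 7; 10; 0; 9; 5; 13; 4; 12; 14; 15; 11; 16; 6; 8]) (Fill 12 (Reduce 7 5
[:: 15; 0])))))) (Branch 8 12 (Branch 11 14 (Fill 14 (Embed 14 false [:: 0; 1; 2; 3; 4; 5; 6; 7;
8; 9; 10; 11; 12; 13; 14; 15; 16])) (Fill 14 (Branch 11 13 (Reduce 10 3 [:: 7; 2]) (Branch 13 15
(Fill 11 (Reduce 10 4 [:: 11; 8; 2])) (Fill 13 (Branch 12 18 (Fill 9 (Reduce 10 1 [:: 9; 0; 2]))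
(Reduce 10 3 [:: 7; 2]))))))) (Fill 12 (Branch 13 15 (Branch 8 14 (Fill 11 (Branch 14 16 (Reduce
10 4 [:: 11; 8; 2]) (Branch 14 17 (Reduce 10 4 [:: 11; 8; 2]) (Fill 14 (Reduce 10 4 [:: 11; 8;
2]))))) (Fill 8 (Branch 11 14 (Fill 11 (Branch 9 19 (Reduce 7 4 [:: 8; 11; 2]) (Reduce 2 4 [:: 11;
8]))) (Fill 11 (Branch 15 20 (Branch 9 19 (Embed 14 true [:: 5; 0; 1; 2; 9; 7; 15; 3; 13; 6; 4;
19; 10; 8; 11; 12; 20]) (Reduce 2 4 [:: 11; 8])) (Branch 15 19 (Branch 9 20 (Embed 14 true [:: 5;
0; 1; 2; 9; 7; 15; 3; 13; 6; 4; 20; 10; 8; 11; 12; 19]) (Reduce 2 4 [:: 11; 8])) (Reduce 7 4 [::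
8; 11; 2]))))))) (Reduce 7 3 [:: 10; 2]))))))));
(mkstate [:: false; true; false; true; true; true; true; false; false; false; false; false; true;
true; true] [:: (0,1); (0,5); (0,6); (1,2); (1,9); (2,3); (2,4); (3,7); (3,10); (4,8); (4,11);
(5,7); (6,8); (7,12); (9,13); (10,13); (10,14)] [:: (6,10)],
Branch 9 12 (Embed 6 true [:: 1; 0; 5; 7; 2; 3; 9; 12]) (Embed 15 false [:: 0; 1; 2; 3; 4; 5; 6;
7; 8; 9; 10; 11; 12; 13; 14]));
(mkstate [:: false; true; false; true; true; true; true; false; false] [:: (0,1); (0,5); (0,6);
(1,2); (2,3); (2,4); (3,7); (4,8); (5,7); (6,8)] [::],
Fill 1 (Fill 3 (Fill 4 (Fill 7 (Branch 6 10 (Embed 6 false [:: 0; 1; 2; 3; 5; 7; 6; 10]) (Fill 10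
(Branch 9 13 (Embed 16 false [:: 0; 1; 2; 3; 4; 5; 6; 7; 8; 9; 10; 11; 12; 13; 14]) (Branch 8 12
(Branch 11 14 (Embed 16 false [:: 8; 4; 2; 3; 1; 12; 6; 7; 0; 11; 10; 9; 5; 14; 13]) (Branch 11 13
(Embed 16 false [:: 8; 4; 2; 3; 1; 12; 6; 7; 0; 11; 10; 9; 5; 13; 14]) (Fill 13 (Branch 9 14
(Embed 16 false [:: 0; 1; 2; 3; 4; 5; 6; 7; 8; 9; 10; 11; 12; 14; 13]) (Fill 14 (Branch 5 15
(Embed 16 true [:: 5; 7; 3; 2; 10; 0; 15; 1; 13; 12; 4; 14; 9; 8; 11]) (Branch 5 16 (Embed 16 true
[:: 5; 7; 3; 2; 10; 0; 16; 1; 13; 12; 4; 14; 9; 8; 11]) (Branch 12 16 (Embed 16 true [:: 12; 7; 3;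
2; 10; 8; 16; 4; 13; 5; 1; 14; 11; 0; 9]) (Branch 12 15 (Embed 16 true [:: 12; 7; 3; 2; 10; 8; 15;
4; 13; 5; 1; 14; 11; 0; 9]) (Reduce 10 3 [:: 7; 2])))))))))) (Branch 5 11 (Embed 6 false [:: 0; 1;
2; 4; 5; 11; 6; 8]) (Branch 11 12 (Fill 5 (Fill 6 (Branch 12 16 (Branch 13 16 (Embed 15 true [::
12; 7; 3; 2; 10; 11; 16; 4; 13; 5; 1; 14; 8; 0; 9]) (Branch 14 16 (Embed 15 true [:: 12; 7; 3; 2;
10; 11; 16; 4; 14; 5; 1; 13; 8; 0; 9]) (Fill 16 (Branch 11 13 (Reduce 2 12 [:: 11; 16; 7]) (Branch
11 14 (Embed 6 true [:: 3; 2; 4; 11; 7; 12; 10; 14]) (Fill 11 (Branch 15 18 (Embed 12 true [:: 4;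
11; 12; 7; 16; 2; 8; 3; 6; 18; 5; 17; 10; 15; 0; 1; 9]) (Reduce 7 12 [:: 16; 11])))))))) (Branch 9
14 (Embed 16 false [:: 0; 1; 2; 3; 4; 5; 6; 7; 8; 9; 10; 11; 12; 14; 13]) (Reduce 0 3 [:: 10; 2;
7]))))) (Branch 9 14 (Embed 16 false [:: 0; 1; 2; 3; 4; 5; 6; 7; 8; 9; 10; 11; 12; 14; 13])
(Reduce 2 3 [:: 10; 7]))))))))))));
(mkstate [:: false; true; true; true; false; false; false; false; false; false; true; true; true;
true] [:: (0,1); (0,2); (0,3); (1,4); (1,5); (2,6); (2,7); (3,8); (3,9); (4,10); (4,11); (5,12);
(5,13); (7,12)] [::],
Branch 6 11 (Embed 17 true [:: 1; 0; 2; 6; 7; 4; 5; 11; 12]) (Branch 7 11 (Embed 6 true [:: 1; 0;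
2; 7; 4; 11; 5; 12]) (Branch 8 13 (Embed 17 false [:: 0; 1; 5; 12; 13; 2; 3; 7; 8]) (Branch 7 10
(Embed 6 true [:: 1; 0; 2; 7; 4; 10; 5; 12]) (Branch 9 13 (Embed 17 false [:: 0; 1; 5; 12; 13; 2;
3; 7; 9]) (Branch 6 10 (Embed 17 true [:: 1; 0; 2; 6; 7; 4; 5; 10; 12]) (Branch 8 12 (Embed 6
false [:: 0; 1; 5; 12; 2; 7; 3; 8]) (Branch 9 12 (Embed 6 false [:: 0; 1; 5; 12; 2; 7; 3; 9])
(Reduce 0 1 [:: 4; 5])))))))));
(mkstate [:: false] [::] [::],
Fill 0 (Fill 1 (Fill 2 (Fill 3 (Fill 4 (Fill 5 (Branch 7 12 (Embed 18 false [:: 0; 1; 2; 3; 4; 5;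
6; 7; 8; 9; 10; 11; 12; 13]) (Branch 9 11 (Embed 18 false [:: 0; 1; 3; 2; 5; 4; 8; 9; 6; 7; 12;
13; 11; 10]) (Branch 7 13 (Embed 18 false [:: 0; 1; 2; 3; 4; 5; 6; 7; 8; 9; 10; 11; 13; 12])
(Branch 8 11 (Embed 18 false [:: 0; 1; 3; 2; 5; 4; 9; 8; 6; 7; 12; 13; 11; 10]) (Branch 8 10
(Embed 18 false [:: 0; 1; 3; 2; 5; 4; 9; 8; 6; 7; 12; 13; 10; 11]) (Branch 9 10 (Embed 18 false
[:: 0; 1; 3; 2; 5; 4; 8; 9; 6; 7; 12; 13; 10; 11]) (Branch 6 12 (Embed 18 false [:: 0; 1; 2; 3; 4;
5; 7; 6; 8; 9; 10; 11; 12; 13]) (Branch 6 13 (Embed 18 false [:: 0; 1; 2; 3; 4; 5; 7; 6; 8; 9; 10;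
11; 13; 12]) (Reduce 0 1 [:: 5; 4])))))))))))))))].

Lemma certificates_ok : check_all [:: heawood_table; pappus_table] [::] certificates.
Proof. by vm_compute. Qed.

Lemma B_irreducible_isomorphic (T : finType) (e : rel T) :
  v3_graph e -> connected_graph e -> B_irreducible e ->
  isomorphic e heawood \/ isomorphic e pappus.
Proof.
move=> v3 conn irr; case: (v3) => _ _ [c colc] _; case: (conn) => [[x0 _] _].
have start : exists c', models e c' (fun=> x0) (mkstate [:: false] [::] [::]).
  (* The initial state has one white vertex, so the colours are exchanged if [x0] is black. *)
  have [c' colc' c'0] : exists2 c', proper2col e c' & c' x0 = false.
    case E: (c x0); last by exists c.
    by exists (fun x => ~~ c x); [exact: proper2col_negb | rewrite E].
  by exists c'; split=> //= [[]|[] []|[|[]]|[|[]]|[|[]]].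
case: start => c' start.
apply: (check_all_sound v3 conn irr (P := isomorphic e heawood \/ isomorphic e pappus)
          _ _ _ certificates_ok _ start) => //.
(* The table sizes compute to 14 and 18, so the same [f] has the type needed for [heawood] or
   [pappus]. *)
move=> tbl; rewrite !inE => /orP [] /eqP -> [f [fbij fe]]; [left | right]; exists f; split=> //.
  by move=> x y; rewrite heawood_tableE -fe.
by move=> x y; rewrite pappus_tableE -fe.
Qed.

Theorem theorem1 :
  (v3_graph heawood /\ connected_graph heawood) /\
  (v3_graph pappus /\ connected_graph pappus) /\
  forall (T : finType) (e : rel T),
    v3_graph e -> connected_graph e ->
    (B_irreducible e <-> (isomorphic e heawood \/ isomorphic e pappus)).
Proof.
split; first exact: (table_target heawood_table_ok heawood_tableE).
split; first exact: (table_target pappus_table_ok pappus_tableE).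
move=> T e v3 conn; split; first exact: B_irreducible_isomorphic.
case.
  exact: (isomorphic_B_irreducible heawood_table_ok heawood_tableE).
exact: (isomorphic_B_irreducible pappus_table_ok pappus_tableE).
Qed.
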